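(* Let $m\ge1$ be an integer, $\rho>0$, $y\in\mathbb{R}^m$, and fix $j\in\{1,\dots,m\}$. If $$|y_k|\le\rho\qquad\text{for every }k\ge j,$$ then every maximizer over $p\in\Delta_m$ of the dual problem $$\max_{p\in\Delta_m}\left\{\sum_{i=1}^m p_i(y_i-8\rho i)-\frac\rho4\|p\|_2^2\right\}$$ is supported on $\{1,\dots,j\}$, and $$h_{m,\rho}(y)=h_{m,\rho}(y_1,\dots,y_j,0,\dots,0).$$ In particular, if $y_j=0$, then $$h_{m,\rho}(y)=h_{m,\rho}(y_1,\dots,y_{j-1},0,\dots,0).$$ Consequently, if $i=i_\rho^+(y)\le m$, then the value is exactly independent of $y_{i+1},\dots,y_m$, in the sense that $h_{m,\rho}(y)=h_{m,\rho}(y_1,\dots,y_i,0,\dots,0)$.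
   Context: For $y\in\mathbb{R}^m$, $g_{m,\rho}(y):=\max_{1\le i\le m}\{y_i-8\rho i\}$ and $$h_{m,\rho}(y):=\inf_{z\in\mathbb{R}^m}\left\{g_{m,\rho}(z)+\frac1\rho\|z-y\|_2^2\right\}.$$ $\Delta_m=\{p\in\mathbb{R}^m: p_i\ge0,\ \sum_{i=1}^m p_i=1\}$ is the probability simplex. The robust progress index is $i_\rho^+(y):=\min\{i\in\{1,\dots,m\}:|y_k|\le\rho\text{ for every }k\ge i\}$ (with $k$ ranging over $\{i,\dots,m\}$), and $i_\rho^+(y)=m+1$ if this set is empty. *)

(* Defs.v *)
From HB Require Import structures.
From mathcomp Require Import all_boot all_order all_algebra.
From mathcomp Require Import all_classical all_reals all_analysis.
Set Implicit Arguments.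
Unset Strict Implicit.
Unset Printing Implicit Defensive.
Import Order.TTheory GRing.Theory Num.Theory.
Local Open Scope classical_set_scope.
Local Open Scope ring_scope.

(* The dimension m >= 1 is written n.+1.  Coordinates are indexed from 0 by
   'I_n.+1, so that [y 0 i] is the coordinate y_{i+1}; the penalty attached to
   it is therefore 8 * rho * (i + 1). *)

Definition shifted (R : realType) (n : nat) (rho : R) (y : 'rV[R]_n.+1)
    (i : 'I_n.+1) : R :=
  y 0 i - 8 * rho * i.+1%:R.

Definition g (R : realType) (n : nat) (rho : R) (y : 'rV[R]_n.+1) : R :=
  \big[Num.max/shifted rho y ord0]_(i < n.+1) shifted rho y i.

(* The library norm `|x| on row vectors is the sup norm. *)
Definition l2norm (R : realType) (n : nat) (x : 'rV[R]_n) : R :=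
  Num.sqrt (\sum_(i < n) x 0 i ^+ 2).

(* For 0 < rho the infimum is over a nonempty set of reals bounded below by
   y_1 - 8 * rho - rho / 4, so the default value of [inf] plays no role. *)
Definition h (R : realType) (n : nat) (rho : R) (y : 'rV[R]_n.+1) : R :=
  inf [set g rho z + rho^-1 * l2norm (z - y) ^+ 2 | z in [set: 'rV[R]_n.+1]].

Definition simplex (R : realType) (m : nat) : set 'rV[R]_m :=
  [set p | (forall i, 0 <= p 0 i) /\ \sum_(i < m) p 0 i = 1].

Definition dual_objective (R : realType) (n : nat) (rho : R)
    (y p : 'rV[R]_n.+1) : R :=
  \sum_(i < n.+1) p 0 i * shifted rho y i - rho / 4 * l2norm p ^+ 2.

Definition dual_maximizer (R : realType) (n : nat) (rho : R)
    (y p : 'rV[R]_n.+1) : Prop :=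
  simplex p /\
  forall q, simplex q -> dual_objective rho y q <= dual_objective rho y p.

(* (y_1, ..., y_l, 0, ..., 0) *)
Definition truncate (R : realType) (m : nat) (l : nat) (y : 'rV[R]_m) :
    'rV[R]_m :=
  \row_k (if (k < l)%N then y 0 k else 0).

(* i_rho^+(y), with values in {1, ..., m + 1}: here i is a 1-based index,
   compared with the 1-based index k.+1 of the coordinate [y 0 k]. *)
Definition robust_index (R : realType) (m : nat) (rho : R) (y : 'rV[R]_m) :
    nat :=
  \big[minn/m.+1]_(1 <= i < m.+1 |
      [forall k : 'I_m, (i <= k.+1)%N ==> (`|y 0 k| <= rho)]) i.

(* Main.v *)
Require Import Defs.
From HB Require Import structures.
From mathcomp Require Import all_boot all_order all_algebra.
From mathcomp Require Import all_classical all_reals all_analysis.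
From mathcomp Require Import ring lra.
Set Implicit Arguments.
Unset Strict Implicit.
Unset Printing Implicit Defensive.
Import Order.TTheory GRing.Theory Num.Theory.
Local Open Scope classical_set_scope.
Local Open Scope ring_scope.

(* Moving from coordinate j to a later coordinate k costs at least 8 rho in
   penalty, while y_k exceeds y_j by at most 2 rho.  In the dual, shifting the
   mass p_k onto p_j therefore gains at least 6 rho p_k in the linear term and
   loses only rho p_j p_k / 2 in the quadratic one.  In the primal, any z can be
   replaced by the point with z_k = y_k for k > j, after raising z_j to -7 rho
   if needed: the tail coordinates then never beat the j-th one in g, and the
   raise pays for itself in the quadratic term.  The tail of y thus contributes
   nothing to the infimum. *)

Lemma sqr_l2norm (R : realType) (n : nat) (x : 'rV[R]_n) :
  l2norm x ^+ 2 = \sum_(i < n) x 0 i ^+ 2.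
Proof. by rewrite sqr_sqrtr// sumr_ge0// => i _; exact: sqr_ge0. Qed.

Lemma shifted_le_g (R : realType) (n : nat) (rho : R) (y : 'rV[R]_n.+1) i :
  shifted rho y i <= g rho y.
Proof. exact: le_bigmax. Qed.

Lemma g_le (R : realType) (n : nat) (rho c : R) (y : 'rV[R]_n.+1) :
  (forall i, shifted rho y i <= c) -> g rho y <= c.
Proof. by move=> yc; apply: bigmax_le => // i _; exact: yc. Qed.

Lemma penalty_gap (R : realType) (rho : R) (j k : nat) : 0 < rho ->
  (j < k)%N -> 8 * rho * j.+1%:R + 8 * rho <= 8 * rho * k.+1%:R.
Proof.
move=> rho0 jk; have {jk} : j.+2%:R <= k.+1%:R :> R by rewrite ler_nat.
rewrite -[j.+2%:R]natr1 => jk.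
have := ler_wpM2l (ltW rho0) jk; lra.
Qed.

(** Bound [g] below by its first term and keep only the first square: with
    [u = z 0 ord0 - y 0 ord0], completing the square gives [u + u ^+ 2 / rho >= - rho / 4]. *)
Lemma h_has_lbound (R : realType) (n : nat) (rho : R) (y : 'rV[R]_n.+1) :
  0 < rho ->
  has_lbound [set g rho z + rho^-1 * l2norm (z - y) ^+ 2
             | z in [set: 'rV[R]_n.+1]].
Proof.
move=> rho0; exists (y 0 ord0 - 8 * rho - rho / 4) => _ [z _ <-].
have gz := shifted_le_g rho z ord0; rewrite /shifted mulr1 in gz.
have z0 : (z 0 ord0 - y 0 ord0) ^+ 2 <= l2norm (z - y) ^+ 2.
  rewrite sqr_l2norm (bigD1 ord0)//= !mxE lerDl sumr_ge0// => i _.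
  exact: sqr_ge0.
set q := rho^-1 * _; have qE : l2norm (z - y) ^+ 2 = rho * q.
  by rewrite mulVKf// gt_eqF.
rewrite qE in z0.
have : rho * (y 0 ord0 - z 0 ord0 - rho / 4) <= rho * q.
  apply: le_trans z0; rewrite -subr_ge0.
  rewrite (_ : _ - _ = (z 0 ord0 - y 0 ord0 + rho / 2) ^+ 2) ?sqr_ge0//.
  by field.
rewrite ler_pM2l//; lra.
Qed.

(** Only the tail of [y] has to be small, that of [y'] is arbitrary. Equality for a truncation
    follows by using the inequality in both directions. *)
Lemma le_h_of_eq_head (R : realType) (n : nat) (rho : R) (y y' : 'rV[R]_n.+1)
    (j : 'I_n.+1) : 0 < rho ->
  (forall k : 'I_n.+1, (k <= j)%N -> y 0 k = y' 0 k) ->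
  (forall k : 'I_n.+1, (j <= k)%N -> `|y 0 k| <= rho) ->
  h rho y <= h rho y'.
Proof.
move=> rho0 yy' yrho; apply: lb_le_inf.
  by exists (g rho y' + rho^-1 * l2norm (y' - y') ^+ 2), y'.
move=> _ [z _ <-].
pose w : 'rV[R]_n.+1 := \row_k (if (k < j)%N then z 0 k else
   if k == j then Num.max (z 0 j) (- (7 * rho)) else y 0 k).
have wj : w 0 j = Num.max (z 0 j) (- (7 * rho)) by rewrite mxE ltnn eqxx.
pose t := w 0 j - z 0 j.
have t0 : 0 <= t by rewrite subr_ge0 wj le_max lexx.
have gw : g rho w <= g rho z + t.
  apply: g_le => k; case: (ltngtP k j) => [kj|jk|/val_inj ->].
  - apply: le_trans (_ : g rho z <= _); last by rewrite lerDl.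
    by rewrite /shifted mxE kj; exact: shifted_le_g.
  (* The level [- 7 * rho] is [rho - 8 * rho]: the largest possible [y 0 k] minus the least extra
     penalty beyond [j]. *)
  - have := shifted_le_g rho z j; have := penalty_gap rho0 jk.
    have := yrho k (ltnW jk); rewrite ler_norml => /andP[_ yk].
    have : - (7 * rho) <= w 0 j by rewrite wj le_max lexx orbT.
    rewrite /shifted /t [w 0 k]mxE ltnNge (ltnW jk)/= -val_eqE gtn_eqF//=; lra.
  - have := shifted_le_g rho z j; rewrite /shifted /t; lra.
have qw : l2norm (w - y) ^+ 2 + rho * t <= l2norm (z - y') ^+ 2.
  rewrite !sqr_l2norm (bigD1 j)//= [leRHS](bigD1 j)//= addrAC lerD//.
    rewrite /t !mxE -yy'// ltnn eqxx.
    have := yrho j (leqnn _); rewrite ler_norml => /andP[yj _].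
    case: (leP (z 0 j)) => zj; last by lra.
    (* For a raise of size [t = - 7 * rho - z 0 j], the square drops by
       [t * (t + 2 * y 0 j + 14 * rho)], and [rho * t] of this pays for the increase of [g]. The
       second factor is nonnegative because [y 0 j >= - rho]. *)
    rewrite -subr_ge0 (_ : _ - _ = (- (7 * rho) - z 0 j) *
      ((- (7 * rho) - z 0 j) + (2 * y 0 j + 13 * rho))); last by ring.
    by rewrite mulr_ge0//; lra.
  apply: ler_sum => k; rewrite !mxE -val_eqE /=.
  case: ltngtP => // [kj|jk] _; first by rewrite yy'// ltnW.
  by rewrite subrr expr0n sqr_ge0.
apply: le_trans (_ : g rho w + rho^-1 * l2norm (w - y) ^+ 2 <= _).
  by apply: ge_inf; [exact: h_has_lbound|exists w].
have : rho^-1 * (l2norm (w - y) ^+ 2 + rho * t)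
       <= rho^-1 * l2norm (z - y') ^+ 2 by rewrite ler_pM2l ?invr_gt0.
rewrite mulrDr mulKf ?gt_eqF//; lra.
Qed.

Lemma h_truncate (R : realType) (n : nat) (rho : R) (y : 'rV[R]_n.+1)
    (j : 'I_n.+1) : 0 < rho ->
  (forall k : 'I_n.+1, (j <= k)%N -> `|y 0 k| <= rho) ->
  h rho y = h rho (truncate j.+1 y).
Proof.
move=> rho0 yrho.
have head (k : 'I_n.+1) : (k <= j)%N -> y 0 k = truncate j.+1 y 0 k.
  by move=> kj; rewrite mxE ltnS kj.
apply/le_anti/andP; split; first exact: (le_h_of_eq_head (j := j)).
apply: (le_h_of_eq_head (j := j)) => // k jk; first by rewrite head.
by rewrite mxE; case: ifP => _; [exact: yrho|rewrite normr0 ltW].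
Qed.

Lemma dual_maximizer_support (R : realType) (n : nat) (rho : R)
    (y p : 'rV[R]_n.+1) (j : 'I_n.+1) : 0 < rho ->
  (forall k : 'I_n.+1, (j <= k)%N -> `|y 0 k| <= rho) ->
  dual_maximizer rho y p ->
  forall k : 'I_n.+1, (j < k)%N -> p 0 k = 0.
Proof.
move=> rho0 yrho [[p0 p1] pmax] k jk; apply/eqP; rewrite eq_le p0 andbT leNgt.
apply/negP => pk.
have kj : k != j by rewrite -val_eqE gtn_eqF.
have jk' : j != k by rewrite eq_sym.
pose q : 'rV[R]_n.+1 := \row_i (if i == j then p 0 j + p 0 k else
   if i == k then 0 else p 0 i).
have qj : q 0 j = p 0 j + p 0 k by rewrite mxE eqxx.
have qk : q 0 k = 0 by rewrite mxE (negPf kj) eqxx.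
have qE i : (i != j) && (i != k) -> q 0 i = p 0 i.
  by rewrite mxE => /andP[/negPf-> /negPf->].
have split_sum (F : 'I_n.+1 -> R) :
    \sum_i F i = F j + (F k + \sum_(i | (i != j) && (i != k)) F i).
  by rewrite (bigD1 j)//= (bigD1 k).
have qsimplex : simplex q.
  split=> [i|].
    by rewrite mxE; case: ifP => _; [rewrite addr_ge0|case: ifP].
  rewrite -p1 !split_sum qj qk (eq_bigr (fun i => p 0 i)) //; ring.
have pj : p 0 j <= 1.
  by rewrite -p1 (bigD1 j)//= lerDl sumr_ge0.
have := pmax q qsimplex; rewrite /dual_objective !sqr_l2norm !split_sum qj qk.
rewrite (eq_bigr (fun i => p 0 i * shifted rho y i)); last first.
  by move=> i /qE ->.
rewrite [X in _ - _ * (_ + (_ + X)) <= _](eq_bigr (fun i => p 0 i ^+ 2));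
  last by move=> i /qE ->.
set A := \sum_(i | _) _; set B := \sum_(i | _) _.
have gain : 6 * rho <= shifted rho y j - shifted rho y k.
  have := penalty_gap rho0 jk; have := yrho k (ltnW jk).
  have := yrho j (leqnn _); rewrite !ler_norml /shifted.
  by move=> /andP[? ?] /andP[? ?]; lra.
apply/negP; rewrite -ltNge -subr_gt0.
(* Merging the two masses increases the sum of squares by [2 * p 0 j * p 0 k]. Since [p 0 j <= 1],
   the second factor is at least [11 / 2 * rho]. *)
rewrite (_ : _ - _ = p 0 k *
  (shifted rho y j - shifted rho y k - rho / 2 * p 0 j)); last by field.
rewrite mulr_gt0//.
have := ler_wpM2l (ltW rho0) pj; lra.
Qed.

(** [minn] returns one of its arguments, so what holds for every admissible index passes to the
    minimum. The default [m.+1] is carried as a separate disjunct, which the hypothesis rules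
    out. *)
Lemma robust_index_spec (R : realType) (m : nat) (rho : R) (y : 'rV[R]_m) :
  (robust_index rho y <= m)%N ->
  (0 < robust_index rho y)%N /\
  forall k : 'I_m, (robust_index rho y <= k.+1)%N -> `|y 0 k| <= rho.
Proof.
rewrite /robust_index big_nat_cond; set r := \big[_/_]_(_ <= _ < _ | _) _.
suff : [|| r == m.+1 | (0 < r)%N &&
    [forall k : 'I_m, (r <= k.+1)%N ==> (`|y 0 k| <= rho)]].
  case/orP=> [/eqP ->|/andP[r0 /forallP rP]]; first by rewrite ltnn.
  by split=> // k; exact/implyP.
rewrite /r; elim/big_ind: _ => [|a b aP bP|i /andP[/andP[i0 _] iP]].
- by rewrite eqxx.
- by case: (leqP a b).
- by rewrite i0 iP orbT.
Qed.

Theorem lemma6p3 (R : realType) (n : nat) (rho : R) (hrho : 0 < rho)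
    (y : 'rV[R]_n.+1) :
  (forall j : 'I_n.+1,
     (forall k : 'I_n.+1, (j <= k)%N -> `|y 0 k| <= rho) ->
     [/\ forall p : 'rV[R]_n.+1, dual_maximizer rho y p ->
           forall k : 'I_n.+1, (j < k)%N -> p 0 k = 0,
         h rho y = h rho (truncate j.+1 y)
       & y 0 j = 0 -> h rho y = h rho (truncate j y)]) /\
  ((robust_index rho y <= n.+1)%N ->
     h rho y = h rho (truncate (robust_index rho y) y)).
Proof.
split=> [j yrho|ile].
  split=> [p||yj0]; [exact: dual_maximizer_support|exact: h_truncate|].
  rewrite (h_truncate hrho yrho); congr (h rho _).
  (* The two truncations differ at most in coordinate [j], where [y] vanishes. *)
  apply/rowP => k; rewrite !mxE ltnS leq_eqVlt.
  by case: eqP => //= /val_inj ->; rewrite ltnn.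
have [] := robust_index_spec ile.
(* The robust index is 1-based: when it equals [i.+1], the ordinal to use is [i], and [truncate]
   keeps [i.+1] coordinates. *)
case: (robust_index rho y) ile => // i ile _ yrho.
exact: (h_truncate (j := Ordinal ile)).
Qed.
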